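(* Let $\mathcal H^2$ be a two-dimensional complex Hilbert space with orthonormal basis $h_{01},h_{02}$, let $\lambda_0\in\mathbb C$ with $\operatorname{Im}\lambda_0>0$, let $T_m$ be the linear operator in $\mathcal H^2$ with matrix $\begin{pmatrix}\lambda_0&0\\0&\bar\lambda_0\end{pmatrix}$ in this basis, let $K:\mathbb C^2\to\mathcal H^2$ be given by $K(c_1,c_2)^T=\sqrt{\operatorname{Im}\lambda_0}\,(c_1h_{01}+c_2h_{02})$, let $J_m=\begin{pmatrix}1&0\\0&-1\end{pmatrix}$ on $\mathbb C^2$, and let $$\Theta_m=\begin{pmatrix}T_m&K&J_m\\ \mathcal H^2&&\mathbb C^2\end{pmatrix}$$ be the canonical L-system with main operator $T_m$, channel operator $K$ and directing operator $J_m$. Then the dissipation coefficient $\mathcal D_m$ of $\Theta_m$ is zero, that is, $\mathcal D_m=0$.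
   Context: $\operatorname{Im}T=\frac1{2i}(T-T^* )$. A canonical L-system is an array $\Theta=\begin{pmatrix}T&K&J\\ \mathcal H&&E\end{pmatrix}$, where $\mathcal H,E$ are Hilbert spaces with $\dim E<\infty$, $T$ is a bounded operator in $\mathcal H$ (main operator), $K:E\to\mathcal H$ is bounded (channel operator), $J$ is a bounded self-adjoint unitary operator in $E$ (directing operator), and $\operatorname{Im}T=KJK^*$. Its transfer function is $W_\Theta(z)=I-2iK^*(T-zI)^{-1}KJ$, $z\in\rho(T)$. The c-Entropy of $\Theta$ is $\mathcal S=-\operatorname{tr}\ln(|W_\Theta(-i)|)$, where $|W|=(W^*W)^{1/2}$. Convention: if $-i\notin\rho(T)$ or $W_\Theta(-i)$ is singular (here exactly when $\lambda_0=i$), $\mathcal S$ is understood as the limit in $[-\infty,+\infty]$ of $-\operatorname{tr}\ln(|W_\Theta(z)|)$ as $z\to -i$, $z\neq -i$. If $\mathcal S\ge0$, the coefficient of dissipation of $\Theta$ is $\mathcal D=1-e^{-2\mathcal S}$. *)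

(* Defs.v *)
From HB Require Import structures.
From mathcomp Require Import all_boot all_order all_algebra.
From mathcomp Require Import sesquilinear spectral.
From mathcomp Require Import complex.
From mathcomp Require Import all_classical all_reals all_analysis.

Set Implicit Arguments.
Unset Strict Implicit.
Unset Printing Implicit Defensive.

Import Order.TTheory GRing.Theory Num.Theory Num.Def.
Import numFieldNormedType.Exports.

Local Open Scope classical_set_scope.
Local Open Scope ring_scope.

(* Inner products are linear in the first argument and conjugate-linear in the
   second. *)
Record hilbertSpace (R : realType) := HilbertSpace {
  hilbert_sort :> completeNormedModType R[i];
  hdot : {dot hilbert_sort for (@conjC R[i])};
  hilbert_normE : forall x : hilbert_sort, `|x| ^+ 2 = hdot x x }.
Arguments hdot {R} _.

(* No completeness field: a finite-dimensional inner product space is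
   complete. *)
Record finHilbertSpace (R : realType) := FinHilbertSpace {
  finhilbert_sort :> vectType R[i];
  fdot : {dot finhilbert_sort for (@conjC R[i])} }.
Arguments fdot {R} _.

(* Vectors (c_1, c_2)^T are written as row vectors, for which the library has
   the standard inner product \sum_i u_i * (v_i)^*. *)
Definition C2 (R : realType) : finHilbertSpace R :=
  @FinHilbertSpace R 'rV[R[i]]_2 (@dotmx R[i] 2).

Section Operators.
Variables (R : realType) (U V : lmodType R[i]).
Variables (dU : {dot U for (@conjC R[i])}) (dV : {dot V for (@conjC R[i])}).

Definition bounded_op (f : U -> V) : Prop :=
  exists M : R[i], forall x, dV (f x) (f x) <= M * dU x x.

(* The vector representing u |-> <f u, y>, unique by positive definiteness; it
   exists for every bounded linear f on a complete U. *)
Definition adjoint (f : U -> V) (y : V) : U :=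
  xget 0 [set x | forall u, dV (f u) y = dU u x].

End Operators.

Section Resolvent.
Variables (R : realType) (H : hilbertSpace R) (T : {linear H -> H}).

Definition resolvent_set : set R[i] :=
  [set z | exists S : {linear H -> H}, [/\ bounded_op (hdot H) (hdot H) S,
     (forall x, S (T x - z *: x) = x) & (forall x, T (S x) - z *: S x = x)]].

(* (T - zI)^{-1}, meaningful for z in the resolvent set *)
Definition resolvent (z : R[i]) (y : H) : H :=
  xget 0 [set x | T x - z *: x = y].

End Resolvent.

Section FiniteDimensional.
Variables (R : realType) (E : finHilbertSpace R).

(* Functional calculus f(A) = \sum_a f(a) P_a of a self-adjoint A, with P_a the
   orthogonal projection on the eigenspace of a. Since the eigenvectors of A
   span E and its eigenvalues are real, exactly one operator qualifies. *)
Definition opfun (f : R -> R) (A : 'End(E)) : 'End(E) :=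
  xget 0 [set B : 'End(E) | forall (a : R) (v : E),
            A v = (a%:C)%C *: v -> B v = ((f a)%:C)%C *: v].

Definition absop (A : 'End(E)) : 'End(E) :=
  opfun Num.sqrt (linfun (adjoint (fdot E) (fdot E) A \o A)).

Definition optrace (A : 'End(E)) : R[i] :=
  \tr (passmx.mxof (vbasis {:E}) (vbasis {:E}) A).

End FiniteDimensional.

Section LSystem.
Variables (R : realType) (H : hilbertSpace R) (E : finHilbertSpace R).
Variables (T : {linear H -> H}) (K : {linear E -> H}) (J : {linear E -> E}).

Definition canonical_Lsystem : Prop :=
  [/\ bounded_op (hdot H) (hdot H) T,
      bounded_op (fdot E) (hdot H) K,
      bounded_op (fdot E) (fdot E) J,
      [/\ (forall e, adjoint (fdot E) (fdot E) J e = J e),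
          (forall e, adjoint (fdot E) (fdot E) J (J e) = e) &
          (forall e, J (adjoint (fdot E) (fdot E) J e) = e)] &
      forall h, (2 * 'i)^-1 *: (T h - adjoint (hdot H) (hdot H) T h) =
                K (J (adjoint (fdot E) (hdot H) K h))].

Definition transfer (z : R[i]) : 'End(E) :=
  linfun (fun e : E => e - (2 * 'i) *:
    adjoint (fdot E) (hdot H) K (resolvent T z (K (J e)))).

Definition regular_point (z : R[i]) : Prop :=
  resolvent_set T z /\ lker (transfer z) = 0%VS.

(* - tr ln |W(z)|, at regular points; |W(z)| is then positive definite and the
   trace is real, so that taking its real part only changes the type. *)
Definition neg_tr_ln_abs (z : R[i]) : R :=
  - complex.Re (optrace (opfun (@ln R) (absop (transfer z)))).

(* A relation rather than a total function, so that asserting it includes the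
   existence of the limit when -i is not regular. The topology of the modulus
   on R[i] is attached to the alias R[i]^o. *)
Definition is_c_entropy (S : \bar R) : Prop :=
  (regular_point (- 'i) -> S = (neg_tr_ln_abs (- 'i))%:E) /\
  (~ regular_point (- 'i) ->
     (\forall z \near (- 'i : R[i]^o)^', regular_point z) /\
     (neg_tr_ln_abs z)%:E @[z --> (- 'i : R[i]^o)^'] --> S).

Definition is_dissipation_coefficient (D : R) : Prop :=
  exists S : \bar R, [/\ is_c_entropy S, (0 <= S)%E &
    D%:E = (1 - expeR (- (2%:E * S)))%E].

End LSystem.

(* Main.v *)
Require Import Defs.
From HB Require Import structures.
From mathcomp Require Import all_boot all_order all_algebra.
From mathcomp Require Import sesquilinear spectral.
From mathcomp Require Import complex.
From mathcomp Require Import all_classical all_reals all_analysis.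
From mathcomp Require Import ring.

Import Order.TTheory GRing.Theory Num.Theory Num.Def.
Import numFieldNormedType.Exports.

(** The whole system is diagonal, so it splits into two scalar systems, and the
    two cancel.  Put [b := Im lambda0].  In the bases at hand [K^*] is
    [sqrt b] times the coordinate map, the resolvent of [Tm] is
    [diag ((lambda0 - z)^-1, (lambda0^* - z)^-1)], and
    [2 i b = lambda0 - lambda0^*], so the transfer function is diagonal with
    entries
      [1 - 2 i b / (lambda0 - z) = (lambda0^* - z) / (lambda0 - z)]  and
      [1 + 2 i b / (lambda0^* - z) = (lambda0 - z) / (lambda0^* - z)],
    which are inverse to each other ([transfer_model]).  For such a matrix [W],
    [|W|] is the diagonal of the moduli and [tr ln |W|] is the sum of their
    logarithms ([tr_ln_absop_diagop]), that is [ln r + ln r^-1 = 0].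

    Hence [- tr ln |W(z)|] vanishes at every [z] other than [lambda0] and
    [lambda0^*], which are exactly the non-regular points ([regular_model]).
    If [-i] is regular, the c-Entropy is 0 at once; if not (the case
    [lambda0 = i]), it is the limit of a function that is constantly 0 on a
    punctured neighbourhood of [-i], again 0.  So [D = 1 - exp 0 = 0]. *)

Local Open Scope ring_scope.

Set Implicit Arguments.
Unset Strict Implicit.

(** * Adjoints and diagonal operators on the standard Hilbert space *)

(** Testing [x - x'] against itself shows that a representing vector is unique,
    so exhibiting one computes the adjoint. *)
Lemma adjointE (R : realType) (U V : lmodType R[i])
    (dU : {dot U for (@conjC R[i])}) (dV : {dot V for (@conjC R[i])})
    (f : U -> V) (y : V) (x : U) :
  (forall u, dV (f u) y = dU u x) -> adjoint dU dV f y = x.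
Proof.
move=> fyx; apply: xget_unique => //= x' fyx'.
apply/eqP; rewrite -subr_eq0 -(dnorm_eq0 dU); apply/eqP.
by rewrite linearBr /= -fyx' -fyx subrr.
Qed.

(** At [n = 2] this unfolds to the same record as [C2], so what follows applies
    to operators on [C2]. *)
Definition stdHilbert (R : realType) (n : nat) : finHilbertSpace R :=
  @FinHilbertSpace R 'rV[R[i]]_n (@dotmx R[i] n).

Definition diagop (R : realType) (n : nat) (d : 'rV[R[i]]_n) :
    'End(stdHilbert R n) :=
  linfun (mulmxr (diag_mx d) : 'rV[R[i]]_n -> 'rV[R[i]]_n).

Section Diagonal.
Variables (R : realType) (n : nat).
Implicit Types (d v w : 'rV[R[i]]_n) (a : 'rV[R]_n) (f : R -> R).

Lemma dotmx_sum v w : dotmx v w = \sum_j v 0 j * (w 0 j)^*.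
Proof. by rewrite dotmxE mxE; apply: eq_bigr => j _; rewrite !mxE. Qed.

Lemma diagopE d v j : diagop d v 0 j = v 0 j * d 0 j.
Proof. by rewrite lfunE /= mul_mx_diag mxE. Qed.

Lemma diagop_delta d j : diagop d (delta_mx 0 j) = d 0 j *: delta_mx 0 j.
Proof.
apply/rowP => k; rewrite diagopE !mxE eqxx mulrC.
by case: eqP => [->|]//=; rewrite !mulr0.
Qed.

Lemma end_diagop (B : 'End(stdHilbert R n)) d :
  (forall j, B (delta_mx 0 j) = d 0 j *: (delta_mx 0 j : 'rV[R[i]]_n)) ->
  B = diagop d.
Proof.
move=> Bd; apply/lfunP => v; rewrite [v in LHS](row_sum_delta (v : 'rV_n)).
rewrite [v in RHS](row_sum_delta (v : 'rV_n)) !linear_sum.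
by apply: eq_bigr => j _; rewrite !linearZ /= Bd diagop_delta.
Qed.

Lemma adjoint_diagop d v :
  adjoint (fdot (stdHilbert R n)) (fdot (stdHilbert R n)) (diagop d) v =
  diagop (map_mx conjC d) v.
Proof.
apply: adjointE => u /=; rewrite !dotmx_sum; apply: eq_bigr => j _.
by rewrite !diagopE mxE rmorphM /= conjCK mulrA mulrAC.
Qed.

Local Notation realrow a := (map_mx (fun x : R => x%:C%C) a).

(** If [v] is an eigenvector for [c], each coordinate of [v] is zero or has
    diagonal entry [c]; so the diagonal of the [f (a j)] has the required
    eigenvectors.  Conversely the basis vectors are eigenvectors of [diagop], so
    the values of any candidate on them are forced. *)
Lemma opfun_diagop f a :
  opfun f (diagop (realrow a)) = diagop (realrow (map_mx f a)).
Proof.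
apply: xget_unique => /= [c v eigv|B eigB].
  apply/rowP => j; move/rowP/(_ j): eigv; rewrite !diagopE !mxE mulrC.
  have [->|v0 /(mulIf v0)[->]] := eqVneq ((v : 'rV_n) 0 j) 0.
    by rewrite !mul0r !mulr0.
  by rewrite mulrC.
apply: end_diagop => j; rewrite !mxE; apply: eigB.
by rewrite diagop_delta !mxE.
Qed.

(** The trace is taken in an unspecified basis [b].  Expanding the image of each
    [b_i] in the standard basis and exchanging sums, the coefficient of [d_j] is
    the [j]-th coordinate of the expansion of [e_j] in [b], namely 1. *)
Lemma optrace_diagop d : optrace (diagop d) = \sum_j d 0 j.
Proof.
pose E := stdHilbert R n; pose b := vbasis {:E}.
have cE j k :
    \sum_i coord b i (delta_mx 0 j : E) * (b`_i : 'rV_n) 0 k = (k == j)%:R.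
  have /(congr1 (fun v : 'rV_n => v 0 k)) := coord_vbasis (memvf (delta_mx 0 j : E)).
  by rewrite summxE !mxE eqxx /= => ->; apply: eq_bigr => i _; rewrite mxE.
transitivity (\sum_i coord b i (diagop d b`_i)).
  by apply: eq_bigr => i _; rewrite !mxE /= passmx.vecof_delta.
have diagb v : diagop d v = \sum_j (v 0 j * d 0 j) *: (delta_mx 0 j : E).
  rewrite [LHS](row_sum_delta (_ : 'rV_n)).
  by apply: eq_bigr => j _; rewrite diagopE.
under eq_bigr => i _.
  rewrite diagb linear_sum /=.
  under eq_bigr => j _ do rewrite linearZ /= mulrAC mulrC.
  over.
rewrite exchange_big /=; apply: eq_bigr => j _.
rewrite -mulr_sumr -[RHS]mulr1; congr (_ * _).
by under eq_bigr => i _ do rewrite mulrC; rewrite cE eqxx.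
Qed.

Lemma absop_diagop d :
  absop (diagop d) = diagop (realrow (map_mx (@Normc.normc R) d)).
Proof.
rewrite /absop.
(* W^* W is the diagonal of the squared moduli. *)
have -> : linfun (adjoint (fdot (stdHilbert R n)) (fdot (stdHilbert R n))
             (diagop d) \o diagop d) =
           diagop (realrow (map_mx (fun x => Normc.normc x ^+ 2) d)).
  have -> : adjoint (fdot (stdHilbert R n)) (fdot (stdHilbert R n))
             (diagop d) \o diagop d =
            mulmxr (diag_mx (realrow (map_mx (fun x => Normc.normc x ^+ 2) d))).
    apply: funext => v /=; rewrite adjoint_diagop; apply/rowP => j.
    rewrite !diagopE mul_mx_diag !mxE -mulrA -normCK normc_def.
    by case: (d 0 j) => x y /=; rewrite rmorphXn.
  by [].
rewrite opfun_diagop; congr diagop; apply/rowP => j; rewrite !mxE.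
rewrite sqrtr_sqr ger0_norm//.
by case: (d 0 j) => x y; exact: sqrtr_ge0.
Qed.

Lemma tr_ln_absop_diagop d :
  optrace (opfun (@ln R) (absop (diagop d))) =
  \sum_j (ln (Normc.normc (d 0 j)))%:C%C.
Proof.
rewrite absop_diagop opfun_diagop optrace_diagop.
by apply: eq_bigr => j _; rewrite !mxE.
Qed.

Lemma lker_diagop d : (forall j, d 0 j != 0) -> lker (diagop d) = 0%VS.
Proof.
move=> d0; apply/eqP/lker0P => u v uv; apply/rowP => j.
by apply: (mulIf (d0 j)); rewrite -!diagopE uv.
Qed.

End Diagonal.

(** * Diagonal operators in an orthonormal basis of two vectors *)

Section OrthonormalPair.
Variables (R : realType) (H : hilbertSpace R) (h1 h2 : H).
Variables (h11 : hdot H h1 h1 = 1) (h22 : hdot H h2 h2 = 1).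
Variables (h12 : hdot H h1 h2 = 0).
Variable (span12 : forall h : H, exists a b : R[i], h = a *: h1 + b *: h2).
Implicit Types (a b c d z : R[i]) (h : H).

Lemma hdot_onb a b c d :
  hdot H (a *: h1 + b *: h2) (c *: h1 + d *: h2) = a * c^* + b * d^*.
Proof.
have h21 : hdot H h2 h1 = 0.
  by apply/eqP; rewrite (herm_eq0C (hdot H)); apply/eqP.
rewrite linearDl /= !linearZl_LR /= !linearDr /= !linearZr_LR /=.
rewrite h11 h22 h12 h21 !mulr0 !mulr1 !scaler0 addr0 add0r.
by rewrite [a * _]mulrC [b * _]mulrC.
Qed.

Lemma coord_onb a b :
  (hdot H (a *: h1 + b *: h2) h1 = a) * (hdot H (a *: h1 + b *: h2) h2 = b).
Proof.
have := hdot_onb a b 1 0; have := hdot_onb a b 0 1.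
rewrite !scale1r !scale0r addr0 add0r => -> ->.
by rewrite !rmorph1 !rmorph0 !mulr1 !mulr0 addr0 add0r.
Qed.

Lemma onb_inj a b c d :
  a *: h1 + b *: h2 = c *: h1 + d *: h2 -> a = c /\ b = d.
Proof.
move=> e; have := coord_onb a b; rewrite e.
by move=> [<- <-]; rewrite !coord_onb.
Qed.

(** Written with inner products rather than coordinates, so that linearity needs
    no choice of an expansion of [h]. *)
Definition onb_diag a b h : H :=
  (a * hdot H h h1) *: h1 + (b * hdot H h h2) *: h2.

Lemma onb_diag_linear a b : linear (onb_diag a b).
Proof.
move=> k u v; rewrite /onb_diag !linearPl /= !mulrDr !scalerDl scalerDr !scalerA.
by rewrite [a * (k * _)]mulrCA [b * (k * _)]mulrCA addrACA.
Qed.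

HB.instance Definition _ a b :=
  GRing.isLinear.Build R[i] H H _ (onb_diag a b) (@onb_diag_linear a b).

Lemma onb_diagE a b c d :
  onb_diag a b (c *: h1 + d *: h2) = (a * c) *: h1 + (b * d) *: h2.
Proof. by rewrite /onb_diag !coord_onb. Qed.

Lemma bounded_onb_diag a b : bounded_op (hdot H) (hdot H) (onb_diag a b).
Proof.
exists (`|a| ^+ 2 + `|b| ^+ 2) => h; have [c [d ->]] := span12 h.
rewrite onb_diagE !hdot_onb -!normCK !normrM !exprMn mulrDr !mulrDl.
by rewrite lerD// ?lerDl ?lerDr mulr_ge0 ?exprn_ge0//.
Qed.

Lemma adjoint_onb_diag a b h :
  adjoint (hdot H) (hdot H) (onb_diag a b) h = onb_diag a^* b^* h.
Proof.
apply: adjointE => u; have [c [d ->]] := span12 h; have [c' [d' ->]] := span12 u.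
by rewrite !onb_diagE !hdot_onb !rmorphM /= !conjCK; ring.
Qed.

Section Diagonal.
Variables (l1 l2 : R[i]) (T : {linear H -> H}).
Variables (Th1 : T h1 = l1 *: h1) (Th2 : T h2 = l2 *: h2).

Lemma eigen_onb_diag : T = onb_diag l1 l2 :> (H -> H).
Proof.
apply: funext => h; have [a [b ->]] := span12 h.
rewrite onb_diagE linearD !linearZ /= Th1 Th2 !scalerA.
by rewrite [a * _]mulrC [b * _]mulrC.
Qed.

Lemma shift_onb z a b :
  T (a *: h1 + b *: h2) - z *: (a *: h1 + b *: h2) =
  ((l1 - z) * a) *: h1 + ((l2 - z) * b) *: h2.
Proof.
rewrite eigen_onb_diag onb_diagE scalerDr !scalerA opprD addrACA.
by rewrite -!scalerBl.
Qed.

Lemma resolvent_onb z a b : l1 != z -> l2 != z ->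
  resolvent T z (a *: h1 + b *: h2) =
  ((l1 - z)^-1 * a) *: h1 + ((l2 - z)^-1 * b) *: h2.
Proof.
move=> l1z l2z; have k1 : l1 - z != 0 by rewrite subr_eq0.
have k2 : l2 - z != 0 by rewrite subr_eq0.
apply: xget_unique => /= [|h]; first by rewrite shift_onb !mulVKf.
have [c [d ->]] := span12 h; rewrite shift_onb => /onb_inj[<- <-].
by rewrite !mulKf.
Qed.

(** At an eigenvalue a left inverse would send 0 to a unit eigenvector. *)
Lemma resolvent_set_onb z : resolvent_set T z <-> l1 != z /\ l2 != z.
Proof.
split=> [[S [_ STz _]]|[l1z l2z]]; last first.
  have k1 : l1 - z != 0 by rewrite subr_eq0.
  have k2 : l2 - z != 0 by rewrite subr_eq0.
  exists (onb_diag (l1 - z)^-1 (l2 - z)^-1); split.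
  - exact: bounded_onb_diag.
  - move=> h; have [a [b ->]] := span12 h.
    by rewrite shift_onb /= onb_diagE !mulKf.
  - move=> h; have [a [b ->]] := span12 h.
    by rewrite /= onb_diagE shift_onb !mulVKf.
have nz0 h : hdot H h h = 1 -> h <> 0.
  by move=> + h0; rewrite h0 linear0l => /eqP; rewrite eq_sym oner_eq0.
split; apply/eqP => lz.
  by apply: (nz0 h1) => //; rewrite -(STz h1) Th1 lz subrr linear0.
by apply: (nz0 h2) => //; rewrite -(STz h2) Th2 lz subrr linear0.
Qed.

End Diagonal.
End OrthonormalPair.

Definition row2 (C : Type) (a b : C) : 'rV[C]_2 :=
  \row_(j < 2) (if j == 0 then a else b).

Lemma row2E (C : Type) (a b : C) :
  (row2 a b 0 0 = a) * (row2 a b 0 1 = b).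
Proof. by rewrite !mxE. Qed.

Lemma row2P (C : Type) (u v : 'rV[C]_2) :
  u 0 0 = v 0 0 -> u 0 1 = v 0 1 -> u = v.
Proof.
move=> e0 e1; apply/rowP => j.
by have [->//|->//] : j = 0 \/ j = 1;
   case: j => [[|[|//]] ?]; [left|right]; apply: val_inj.
Qed.

(** * The system with main operator diag(lambda0, lambda0^* ) *)

Section ModelSystem.
Variables (R : realType) (H2 : hilbertSpace R) (h01 h02 : H2).
Variables (h01_unit : hdot H2 h01 h01 = 1) (h02_unit : hdot H2 h02 h02 = 1).
Variables (h01_h02_ortho : hdot H2 h01 h02 = 0).
Variables (h01_h02_span :
  forall h : H2, exists a b : R[i], h = a *: h01 + b *: h02).
Variables (lambda0 : R[i]) (Im_lambda0_gt0 : 0 < 'Im lambda0).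
Variables (Tm : {linear H2 -> H2}) (K : {linear C2 R -> H2}).
Variables (Jm : {linear C2 R -> C2 R}).
Variables (Tm_h01 : Tm h01 = lambda0 *: h01).
Variables (Tm_h02 : Tm h02 = lambda0^* *: h02).
Variables (KE : forall c : 'rV[R[i]]_2,
  K c = sqrtC ('Im lambda0) *: (c 0 0 *: h01 + c 0 1 *: h02)).
Variables (JmE : forall c : 'rV[R[i]]_2,
  Jm c = \row_(j < 2) (if j == 0 then c 0 0 else - c 0 1)).

Local Notation b := ('Im lambda0).

Lemma dot_C2 (u v : 'rV[R[i]]_2) :
  fdot (C2 R) u v = u 0 0 * (v 0 0)^* + u 0 1 * (v 0 1)^*.
Proof.
rewrite [LHS](dotmx_sum u v) !big_ord_recl big_ord0 addr0.
by rewrite (_ : lift _ _ = 1)//; apply: val_inj.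
Qed.

Lemma conj_sqrt_Im : (sqrtC b)^* = sqrtC b.
Proof. by apply: geC0_conj; rewrite sqrtC_ge0 ltW. Qed.

Lemma adjoint_channel a c :
  adjoint (fdot (C2 R)) (hdot H2) K (a *: h01 + c *: h02) =
  sqrtC b *: row2 a c.
Proof.
apply: adjointE => u; rewrite KE scalerDr !scalerA dot_C2.
rewrite hdot_onb// !mxE !rmorphM /= conj_sqrt_Im.
by ring.
Qed.

Lemma canonical_model : canonical_Lsystem Tm K Jm.
Proof.
have TE := eigen_onb_diag h01_unit h02_unit h01_h02_ortho h01_h02_span
  Tm_h01 Tm_h02.
have adjJ e : adjoint (fdot (C2 R)) (fdot (C2 R)) Jm e = Jm e.
  apply: adjointE => u; rewrite !JmE !dot_C2 !row2E.
  by rewrite mulNr rmorphN mulrN.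
have JJ e : Jm (Jm e) = e.
  by rewrite !JmE; apply: row2P; rewrite !row2E ?opprK.
split.
- by rewrite TE; exact: bounded_onb_diag.
- exists b => c; rewrite KE dnormZ hdot_onb// dot_C2.
  by rewrite ger0_norm ?sqrtC_ge0 ?sqrtCK// ltW.
- exists 1 => c; rewrite JmE mul1r !dot_C2 !row2E.
  by rewrite rmorphN mulrNN.
- by split => e; rewrite ?adjJ.
move=> h; have [a [c ->]] := h01_h02_span h.
rewrite adjoint_channel TE adjoint_onb_diag// !onb_diagE// conjCK.
rewrite !linearZ /= JmE KE !row2E !scalerA -expr2 sqrtCK.
rewrite scalerBr !scalerDr !scalerA opprD addrACA -!scalerBl.
(* Both coordinates reduce to (lambda0 - lambda0^* ) / (2 i) = Im lambda0, with
   the sign in the second one supplied by Jm. *)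
by congr (_ *: _ + _ *: _); rewrite ImE invfM invCi /=; field.
Qed.

(** The transfer function of the dissipative scalar system with main operator
    [lambda0]: a Blaschke factor of a half-plane. *)
Definition blaschke z := (lambda0^* - z) / (lambda0 - z).

(** The second entry is the transfer function of the system with [lambda0^*] and
    directing operator [-1]; swapping [lambda0] and [lambda0^*] inverts the
    factor. *)
Lemma transfer_model z : lambda0 != z -> lambda0^* != z ->
  transfer Tm K Jm z = diagop (row2 (blaschke z) (blaschke z)^-1).
Proof.
move=> l1z l2z; have k1 : lambda0 - z != 0 by rewrite subr_eq0.
have k2 : lambda0^* - z != 0 by rewrite subr_eq0.
have l2b : 2 * 'i * (sqrtC b * sqrtC b) = lambda0 - lambda0^*.
  rewrite -expr2 sqrtCK ImE; transitivity ('i ^+ 2 * (lambda0^* - lambda0)).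
    by field.
  by rewrite sqrCi mulN1r opprB.
congr linfun; apply: funext => e /=.
rewrite JmE KE !row2E scalerDr !scalerA.
rewrite (resolvent_onb h01_unit h02_unit h01_h02_ortho h01_h02_span
  Tm_h01 Tm_h02)// adjoint_channel.
apply: row2P; rewrite mul_mx_diag !mxE /= /blaschke.
  transitivity (e 0 0 - 2 * 'i * (sqrtC b * sqrtC b) * (lambda0 - z)^-1 * e 0 0).
    by ring.
  by rewrite l2b; field.
transitivity (e 0 1 + 2 * 'i * (sqrtC b * sqrtC b) * (lambda0^* - z)^-1 * e 0 1).
  by ring.
by rewrite l2b; field; rewrite k1 k2.
Qed.

Lemma blaschke_neq0 z : lambda0 != z -> lambda0^* != z -> blaschke z != 0.
Proof. by move=> l1z l2z; rewrite mulf_neq0 ?invr_eq0 ?subr_eq0. Qed.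

Lemma neg_tr_ln_abs_model z : lambda0 != z -> lambda0^* != z ->
  neg_tr_ln_abs Tm K Jm z = 0.
Proof.
move=> l1z l2z; have w0 := blaschke_neq0 l1z l2z.
rewrite /neg_tr_ln_abs transfer_model//.
rewrite [optrace _](tr_ln_absop_diagop _) !big_ord_recl big_ord0 addr0 !mxE /=.
have n0 : 0 < Normc.normc (blaschke z).
  rewrite lt_def (contraNneq _ w0) => [|/Normc.eq0_normc/eqP//].
  by case: (blaschke z) => x y; exact: sqrtr_ge0.
by rewrite Normc.normcV lnV// subrr oppr0.
Qed.

Lemma regular_model z :
  regular_point Tm K Jm z <-> lambda0 != z /\ lambda0^* != z.
Proof.
have RS := resolvent_set_onb h01_unit h02_unit h01_h02_ortho h01_h02_span
  Tm_h01 Tm_h02 z.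
split=> [[/RS//]|lz]; split; first exact/RS.
case: lz => l1z l2z; rewrite transfer_model//; apply: lker_diagop => j.
rewrite mxE; case: ifP => _; rewrite ?invr_eq0; exact: blaschke_neq0.
Qed.

(** Only two points fail to be regular, and points are closed. *)
Lemma near_regular_model z0 :
  (\forall z \near (z0 : R[i]^o)^', regular_point Tm K Jm z)%classic.
Proof.
have near_neq (p : R[i]^o) : (\forall z \near (z0 : R[i]^o)^', p != z)%classic.
  have [->|pz0] := eqVneq p z0.
    by near=> z; rewrite eq_sym; near: z; exact: nbhs_dnbhs_neq.
  have op : open [set z : R[i]^o | p != z]%classic.
    have -> : [set z : R[i]^o | p != z]%classic = (~` [set p])%classic.
      by apply/seteqP; split=> z /=; [move/eqP/nesym|move=> /nesym/eqP].
    apply: closed_openC; apply: accessible_closed_set1.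
    exact/hausdorff_accessible/norm_hausdorff.
  by apply: nbhs_dnbhs; exact: open_nbhs_nbhs (conj op pz0).
near=> z; apply/regular_model; split; near: z; exact: near_neq.
Unshelve. all: by end_near. Qed.

(** Both clauses of the definition are met whatever [lambda0] is: the value at
    regular points is always 0, so the limit at a non-regular [-i] exists. *)
Lemma c_entropy_model : is_c_entropy Tm K Jm 0.
Proof.
split=> [/regular_model[l1 l2]|_]; first by rewrite neg_tr_ln_abs_model.
have near_reg := near_regular_model (- 'i); split=> //.
apply: cvg_near_cst; apply: filterS near_reg => z /regular_model[l1 l2].
by rewrite neg_tr_ln_abs_model.
Qed.

End ModelSystem.

Unset Implicit Arguments.

Theorem theorem9 (R : realType) (H2 : hilbertSpace R) (h01 h02 : H2)
    (h01_unit : hdot H2 h01 h01 = 1) (h02_unit : hdot H2 h02 h02 = 1)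
    (h01_h02_ortho : hdot H2 h01 h02 = 0)
    (h01_h02_span : forall h : H2, exists a b : R[i], h = a *: h01 + b *: h02)
    (lambda0 : R[i]) (Im_lambda0_gt0 : 0 < 'Im lambda0)
    (Tm : {linear H2 -> H2}) (K : {linear C2 R -> H2})
    (Jm : {linear C2 R -> C2 R})
    (Tm_h01 : Tm h01 = lambda0 *: h01) (Tm_h02 : Tm h02 = lambda0^* *: h02)
    (KE : forall c : 'rV[R[i]]_2,
       K c = sqrtC ('Im lambda0) *: (c 0 0 *: h01 + c 0 1 *: h02))
    (JmE : forall c : 'rV[R[i]]_2,
       Jm c = \row_(j < 2) (if j == 0 then c 0 0 else - c 0 1)) :
  canonical_Lsystem Tm K Jm /\ is_dissipation_coefficient Tm K Jm 0.
Proof.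
split.
  exact: (canonical_model h01_unit h02_unit h01_h02_ortho h01_h02_span
    Im_lambda0_gt0 Tm_h01 Tm_h02 KE JmE).
exists 0%E; split=> //.
  exact: (c_entropy_model h01_unit h02_unit h01_h02_ortho h01_h02_span
    Im_lambda0_gt0 Tm_h01 Tm_h02 KE JmE).
by rewrite mule0 oppe0 expeR0 subee.
Qed.
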